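(* Let $\mathcal{F}_{\mathrm{IS}}:=\bigcup_{q\in(0,1]}\mathcal{F}_{q}$ be the set of weighted rank functions of independence systems. For every $\gamma\in(0,1]$ and $\alpha\geq\gamma$, the approximation ratio of the greedy algorithm on the class $\tilde{\mathcal{F}}_{\gamma,\alpha}\cap\mathcal{F}_{\mathrm{IS}}$ is exactly $\frac{\alpha}{\gamma}$.
   Context: All functions are set functions $f\colon 2^{U}\to\mathbb{R}_{\geq0}$ on some finite ground set $U$; $f$ is monotone if $X\subseteq Y$ implies $f(X)\leq f(Y)$. Write $[n]=\{1,\dots,n\}$. For $k$, $S^{*}_{k}\in\arg\max_{X\subseteq U,|X|\leq k}f(X)$. The greedy algorithm produces $x_1,x_2,\dots$ with $x_i\in\arg\max_{x\in U\setminus\{x_1,\dots,x_{i-1}\}} f(\{x_1,\dots,x_{i-1}\}\cup\{x\})$, and $S^{G}_i=\{x_1,\dots,x_i\}$, $S^{G}_0=\emptyset$; ties are broken by some rule, and each function is considered together with a fixed such greedy run, to which all notions referring to greedy sets refer. $\bar{k}\in[|U|]$ is the smallest index such that $f(S^{G}_{\bar k}\cup\{x\})=f(S^{G}_{\bar k})$ for all $x\in U\setminus S^{G}_{\bar k}$. For $\gamma\in(0,1]$, $\alpha\geq\gamma$, $f$ is weakly $\gamma$-$\alpha$-augmentable if for all $X\in\{S^{G}_0,\dots,S^{G}_{\bar k}\}$ and all $Y\subseteq U$ with $Y\nsubseteq X$ there is $y\in Y$ with $f(X\cup\{y\})-f(X)\geq\frac{\gamma f(X\cup Y)-\alpha f(X)}{|Y|}$.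 $\tilde{\mathcal{F}}_{\gamma,\alpha}$ is the set of monotone weakly $\gamma$-$\alpha$-augmentable functions. An independence system $(U,\mathcal{I})$ has $\emptyset\in\mathcal{I}\subseteq 2^U$ with $\mathcal{I}$ closed under subsets. For $w\colon U\to\mathbb{R}_{\geq0}$ its weighted rank function is $f(X)=\max\{\sum_{x\in Y}w(x)\mid Y\in\mathcal{I}\cap 2^{X}\}$. The bases $\mathcal{B}(X)$ of $X$ are the inclusion-wise maximal sets of $\mathcal{I}\cap2^X$; the rank quotient is $q(U,\mathcal{I})=\min_{X\subseteq U}\min_{B,B'\in\mathcal{B}(X)}|B|/|B'|$ with $\frac00:=1$. $\mathcal{F}_q$ is the set of weighted rank functions of independence systems with rank quotient at least $q$. The approximation ratio of the greedy algorithm on a class $\mathcal{F}$ is $\sup_{f\in\mathcal{F}}\max_{k\in[|U|]} f(S^{*}_{k})/f(S^{G}_{k})$. *)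

(* Defs.v *)
From HB Require Import structures.
From mathcomp Require Import all_boot all_order all_algebra.

Set Implicit Arguments.
Unset Strict Implicit.
Unset Printing Implicit Defensive.

Import Order.TTheory GRing.Theory Num.Theory.

Local Open Scope ring_scope.

Section SetFunctions.
Context {R : realFieldType} {U : finType}.
Implicit Types (f : {set U} -> R) (s : seq U) (X Y B : {set U}).

Definition monotone_set_fun f := forall X Y, X \subset Y -> f X <= f Y.

Definition optimal_set f (k : nat) : {set U} :=
  [arg max_(X > (set0 : {set U}) | (#|X| <= k)%N) f X]%O.

(* A run [x_1; ...; x_|U|] of the greedy algorithm, under any tie-breaking:
   [x] is the element chosen after the prefix [p]. *)
Definition is_greedy_run f s :=
  size s = #|U| /\
  forall (p : seq U) (x : U) (t : seq U), s = p ++ x :: t ->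
    x \notin p /\
    forall y, y \notin p -> f (y |: [set:: p]) <= f (x |: [set:: p]).

Definition greedy_set s (i : nat) : {set U} := [set:: take i s].

Definition saturated f X := forall x, x \notin X -> f (x |: X) = f X.

(* The index is required to be at least 1, so it exists iff U is nonempty. *)
Definition is_kbar f s (kb : nat) :=
  [/\ (1 <= kb <= #|U|)%N,
      saturated f (greedy_set s kb) &
      forall j, (1 <= j <= #|U|)%N -> saturated f (greedy_set s j) ->
        (kb <= j)%N].

Definition weakly_augmentable (gamma alpha : R) f s :=
  exists2 kb, is_kbar f s kb &
    forall i, (i <= kb)%N -> forall Y, ~~ (Y \subset greedy_set s i) ->
      let X := greedy_set s i in
      exists2 y, y \in Y &
        f (y |: X) - f X >= (gamma * f (X :|: Y) - alpha * f X) / #|Y|%:R.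

Implicit Types (I : {set {set U}}) (w : U -> R).

Definition independence_system I :=
  set0 \in I /\ forall X Y, Y \in I -> X \subset Y -> X \in I.

(* The default 0 is the weight of the empty set, which belongs to [I]. *)
Definition weighted_rank I w X : R :=
  \big[Num.max/0]_(Y in I | Y \subset X) \sum_(x in Y) w x.

Definition bases I X : {set {set U}} :=
  [set B | maxset [pred Y : {set U} | (Y \in I) && (Y \subset X)] B].

Definition card_quotient B B' : R :=
  if (#|B| == 0)%N && (#|B'| == 0)%N then 1 else #|B|%:R / #|B'|%:R.

(* The default 1 does not affect the minimum: for an independence system every
   [X] has a basis, and the quotient of a basis by itself is 1.  A denominator
   can only vanish together with the numerator. *)
Definition rank_quotient I : R :=
  \big[Num.min/1]_(X : {set U})
    \big[Num.min/1]_(B in bases I X) \big[Num.min/1]_(B' in bases I X)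
      card_quotient B B'.

End SetFunctions.

(* Imported only here because classical sets reuse finset's names and notations. *)
From mathcomp Require Import all_classical all_reals all_analysis.
Local Open Scope classical_set_scope.

Record greedy_function (R : realType) := GreedyFunction {
  ground : finType ;
  set_fun :> {set ground} -> R ;
  run : seq ground ;
  set_fun_ge0 : forall X, 0 <= set_fun X ;
  runP : is_greedy_run set_fun run }.

(* Classes are plain predicates: [set (greedy_function R)] is rejected, as the
   universe of [set] lies below that of [finType]. *)
Section Classes.
Context {R : realType}.
Implicit Types (f : greedy_function R) (F : greedy_function R -> Prop).

Definition weakly_augmentable_class (gamma alpha : R) f : Prop :=
  monotone_set_fun f /\ weakly_augmentable gamma alpha f (run f).

Definition weighted_rank_class (q : R) f : Prop :=
  exists (I : {set {set ground f}}) (w : ground f -> R),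
    [/\ independence_system I, (forall x, 0 <= w x),
        q <= rank_quotient I & forall X, f X = weighted_rank I w X].

Definition independence_system_class f : Prop :=
  exists2 q : R, 0 < q <= 1 & weighted_rank_class q f.

(* Conventions: a / 0 = +oo for a > 0, and 0 / 0 = 1. *)
Definition value_ratio (a b : R) : \bar R :=
  if b == 0 then (if a == 0 then 1%E else +oo%E) else (a / b)%:E.

Definition greedy_ratio f : \bar R :=
  \big[maxe/-oo%E]_(1 <= k < #|ground f|.+1)
    value_ratio (f (optimal_set f k)) (f (greedy_set (run f) k)).

Definition approximation_ratio F : \bar R :=
  ereal_sup [set r | exists2 f, F f & r = greedy_ratio f].

End Classes.

(* Main.v *)
(** Upper bound: before saturation, every greedy set is independent and an
    element [y] has gain [0] or [w y] there.  Hence, by induction on [k], an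
    independent set [B] of size at most [k] either has an element no heavier
    than the last greedy gain, which can be removed from [B], or has gain [0]
    throughout at the previous greedy set, where augmentability bounds its
    weight by [alpha / gamma] times the greedy value.  After saturation all
    gains vanish and augmentability applies to the whole ground set.

    Lower bound: take [n] elements of weight [1], of which at most one may be
    used and only alone, and [n] jointly independent elements of weight
    [alpha / (gamma * n) <= 1].  Greedy may choose the former first and is
    then stuck at value [1], while the optimum for [k = n] is [alpha / gamma]. *)

Require Import Defs.
From HB Require Import structures.
From mathcomp Require Import all_boot all_order all_algebra.

Set Implicit Arguments.
Unset Strict Implicit.
Unset Printing Implicit Defensive.

Import Order.TTheory GRing.Theory Num.Theory.
Local Open Scope ring_scope.

(** * Greedy prefixes and optimal sets *)

Section GreedyRuns.
Context {R : realFieldType} {U : finType}.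
Implicit Types (f : {set U} -> R) (s : seq U) (X : {set U}).

Lemma greedy_set0 s : greedy_set s 0 = set0.
Proof. by rewrite /greedy_set take0 set_nil. Qed.

Lemma greedy_setS f s i : is_greedy_run f s -> (i < #|U|)%N ->
  exists x, [/\ x \notin greedy_set s i,
                greedy_set s i.+1 = x |: greedy_set s i &
                forall y, y \notin greedy_set s i ->
                  f (y |: greedy_set s i) <= f (greedy_set s i.+1)].
Proof.
move=> [sz run] lti; case E: (drop i s) => [|x t].
  by move: (congr1 size E) => /eqP; rewrite size_drop sz subn_eq0 leqNgt lti.
have es : s = take i s ++ x :: t by rewrite -E cat_take_drop.
have [xN xmax] := run _ _ _ es.
have eS : greedy_set s i.+1 = x |: greedy_set s i.
  rewrite /greedy_set (take_nth x) ?sz //.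
  have -> : nth x s i = x by rewrite -[i in LHS]addn0 -nth_drop E.
  by apply/setP => z; rewrite !inE mem_rcons inE.
exists x; split=> //; first by rewrite inE.
by move=> y; rewrite inE eS => /xmax.
Qed.

Lemma sub_greedy_set s i j : (i <= j)%N ->
  greedy_set s i \subset greedy_set s j.
Proof.
move=> leij; apply/subsetP => x; rewrite !inE.
by rewrite -(subnKC leij) takeD mem_cat => ->.
Qed.

Lemma optimal_set_card f k : (#|optimal_set f k| <= k)%N.
Proof. by rewrite /optimal_set; case: arg_maxP => //; rewrite cards0. Qed.

Lemma optimal_set_max f k X : (#|X| <= k)%N -> f X <= f (optimal_set f k).
Proof.
by move=> Xk; rewrite /optimal_set; case: arg_maxP => [|Y _]; [rewrite cards0 | apply].
Qed.

End GreedyRuns.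

(** * Weighted rank functions of independence systems *)

Section WeightedRank.
Context {R : realFieldType} {U : finType} {I : {set {set U}}} {w : U -> R}.
Context (indI : independence_system I) (w_ge0 : forall x, 0 <= w x).
Implicit Types (X Y Z : {set U}) (s : seq U).

Local Notation wt Z := (\sum_(x in Z) w x).
Local Notation f := (weighted_rank I w).

Lemma weight_ge0 Z : 0 <= wt Z.
Proof. exact: sumr_ge0. Qed.

Lemma weight_le_rank X Z : Z \in I -> Z \subset X -> wt Z <= f X.
Proof.
by move=> ZI ZX; apply: (@le_bigmax_cond _ _ _ _ Z) => //; rewrite ZI.
Qed.

Lemma rank_attained X :
  exists Z, [/\ Z \in I, Z \subset X & f X = wt Z].
Proof.
rewrite /weighted_rank (@bigmax_eq_arg _ _ _ _ set0); last 2 first.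
- by rewrite indI.1 sub0set.
- by move=> *; exact: weight_ge0.
case: arg_maxP => [|Z /andP[ZI ZX] _]; first by rewrite indI.1 sub0set.
by exists Z.
Qed.

Lemma rank_le X b : (forall Z, Z \in I -> Z \subset X -> wt Z <= b) -> f X <= b.
Proof. by have [Z [ZI ZX ->]] := rank_attained X; apply. Qed.

Lemma rank_monotone : monotone_set_fun f.
Proof.
move=> X Y XY; apply: rank_le => Z ZI ZX.
exact/weight_le_rank/subset_trans/XY.
Qed.

Lemma rank_ge0 X : 0 <= f X.
Proof. by have [Z [_ _ ->]] := rank_attained X; exact: weight_ge0. Qed.

Lemma weight_sub Y Z : Y \subset Z -> wt Y <= wt Z.
Proof.
move=> YZ; rewrite [leRHS](big_setID Y) /= (setIidPr YZ) lerDl.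
exact: weight_ge0.
Qed.

Lemma rank_indep X : X \in I -> f X = wt X.
Proof.
move=> XI; apply: le_anti; rewrite weight_le_rank // andbT.
by apply: rank_le => Z _; exact: weight_sub.
Qed.

Lemma rank_insert_indep X y : y \notin X -> y |: X \in I ->
  f (y |: X) = w y + f X.
Proof.
move=> yX yXI; rewrite rank_indep // big_setU1 //= rank_indep //.
exact: indI.2 yXI (subsetUr _ _).
Qed.

(* An independent set [Z] containing [y] misses some greedy element; if [x] is
   the first one missed, then [y] could have been chosen instead of [x], so
   [w y <= w x] and exchanging [y] for [x] loses no weight. *)
Lemma rank_insert_dep s i y : is_greedy_run f s -> (i <= #|U|)%N ->
    greedy_set s i \in I -> y \notin greedy_set s i ->
    y |: greedy_set s i \notin I ->
  f (y |: greedy_set s i) = f (greedy_set s i).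
Proof.
move=> run leiU SI yS yNI; apply: le_anti.
rewrite [X in _ && X]rank_monotone ?subsetUr // andbT; apply: rank_le => Z ZI ZyS.
have [yZ|yZ] := boolP (y \in Z); last first.
  rewrite weight_le_rank //; apply/subsetP => z zZ.
  by have /setU1P[zy|//] := subsetP ZyS z zZ; rewrite -zy zZ in yZ.
have SNZ : ~~ (greedy_set s i \subset Z).
  apply: contra yNI => SZ; apply: indI.2 ZI _.
  by rewrite subUset sub1set yZ.
have [j [ltji SjZ SjNZ]] : exists j, [/\ (j < i)%N, greedy_set s j \subset Z &
    ~~ (greedy_set s j.+1 \subset Z)].
  elim: i SNZ {leiU SI yS yNI ZyS} => [|i IHi] SNZ.
    by rewrite greedy_set0 sub0set in SNZ.
  have [SiZ|/IHi[j [? ? ?]]] := boolP (greedy_set s i \subset Z).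
    by exists i.
  by exists j; split=> //; exact: ltnW.
have [x [xSj eSj xmax]] := greedy_setS run (leq_trans ltji leiU).
have ySj : y \notin greedy_set s j.
  by apply: contra yS; apply/subsetP/sub_greedy_set/ltnW.
have xZ : x \notin Z by apply: contra SjNZ; rewrite eSj subUset sub1set SjZ => ->.
have xSi : x \in greedy_set s i.
  by apply: (subsetP (sub_greedy_set s ltji)); rewrite eSj setU11.
have wyx : w y <= w x.
  have ySjI : y |: greedy_set s j \in I.
    by apply: indI.2 ZI _; rewrite subUset sub1set yZ.
  have xSjI : x |: greedy_set s j \in I.
    by rewrite -eSj; apply: indI.2 SI _; exact: sub_greedy_set.
  by have := xmax _ ySj; rewrite eSj !rank_insert_indep // lerD2r.
have ZDS : Z :\ y \subset greedy_set s i :\ x.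
  apply/subsetP => z /setD1P[zy zZ].
  have /setU1P[zy'|zS] := subsetP ZyS z zZ; first by rewrite zy' eqxx in zy.
  by rewrite in_setD1 zS andbT; apply: contraNneq xZ => <-.
rewrite rank_indep // (big_setD1 y yZ) (big_setD1 x xSi) /=.
by rewrite lerD // weight_sub.
Qed.

Lemma rank_insert_gain s i y : is_greedy_run f s -> (i <= #|U|)%N ->
    greedy_set s i \in I ->
  f (y |: greedy_set s i) = f (greedy_set s i) \/
  f (y |: greedy_set s i) = w y + f (greedy_set s i).
Proof.
move=> run leiU SI; have [yS|yS] := boolP (y \in greedy_set s i).
  by left; rewrite (setUidPr _) ?sub1set.
have [yI|yNI] := boolP (y |: greedy_set s i \in I).
  by right; exact: rank_insert_indep.
by left; exact: rank_insert_dep.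
Qed.

(** Every independent singleton gains its own weight over the empty set, so saturation there forces
    all these weights to be zero. This case is split off because [is_kbar] ranges only over indices
    from 1. *)
Lemma saturated_set0_rank0 X : saturated f set0 -> f X = 0.
Proof.
move=> sat; have [Z [ZI _ ->]] := rank_attained X.
apply: big1 => x xZ.
have xI : [set x] \in I by apply: indI.2 ZI _; rewrite sub1set.
have := sat x; rewrite inE => /(_ isT).
by rewrite setU0 !rank_indep ?indI.1 // big_set0 big_set1.
Qed.

(** A greedy choice that destroys independence gains nothing; being the best choice, it shows that
    the preceding set was already saturated, against the minimality of [kb]. *)
Lemma greedy_set_indep s kb i : is_greedy_run f s -> is_kbar f s kb ->
  ~ saturated f set0 -> (i <= kb)%N -> greedy_set s i \in I.
Proof.
move=> run [/andP[kb1 kbU] _ kbmin] nsat0.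
elim: i => [|i IHi] leik; first by rewrite greedy_set0 indI.1.
have SI := IHi (ltnW leik).
have leiU : (i < #|U|)%N by apply: leq_trans leik kbU.
have [x [xS eS xmax]] := greedy_setS run leiU.
apply: contraPT leik => SNI.
rewrite eS in SNI.
have sat : saturated f (greedy_set s i).
  move=> y yS; apply: le_anti; rewrite [X in _ && X]rank_monotone ?subsetUr // andbT.
  by have := xmax _ yS; rewrite eS (rank_insert_dep run (ltnW leiU) SI xS SNI).
(* Minimality of [kb] says nothing about index 0; there the contradiction comes from
   [~ saturated f set0]. *)
case: i sat {IHi SI xS eS xmax SNI} leiU => [|i] sat leiU.
  by rewrite greedy_set0 in sat.
by apply/negP; rewrite -leqNgt; apply: kbmin sat; rewrite (ltnW leiU).
Qed.

(** * Upper bound from weak augmentability *)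

Section Augmentable.
Context {gamma alpha : R} (gamma_gt0 : 0 < gamma) (gamma_le : gamma <= alpha).
Context {s : seq U} (run : is_greedy_run f s).

Let alpha_ge0 : 0 <= alpha.
Proof. exact: le_trans (ltW gamma_gt0) gamma_le. Qed.

(** Zero gains force the numerator of the augmentability bound to be at most zero; monotonicity then
    passes from [X :|: Y] to [Y]. *)
Lemma augment_gain0 X Y :
  (exists2 y, y \in Y &
     f (y |: X) - f X >= (gamma * f (X :|: Y) - alpha * f X) / #|Y|%:R) ->
  (forall y, y \in Y -> f (y |: X) = f X) -> gamma * f Y <= alpha * f X.
Proof.
move=> [y yY +] gain0; rewrite gain0 // subrr.
have Ygt0 : 0 < #|Y|%:R :> R by rewrite ltr0n; apply/card_gt0P; exists y.
rewrite ler_pdivrMr // mul0r subr_le0; apply: le_trans.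
by rewrite ler_pM2l // rank_monotone // subsetUr.
Qed.

(** Covers the sets inside a greedy set, about which augmentability is silent. *)
Lemma gamma_alpha_sub X Y : Y \subset X -> gamma * f Y <= alpha * f X.
Proof.
move=> YX; apply: ler_pM => //; [exact: ltW | exact: rank_ge0 |].
exact: rank_monotone.
Qed.

(* Either some element of [B] weighs at most the last greedy gain and can be
   removed, or no element of [B] has a positive gain at the previous greedy
   set, where augmentability applies. *)
Lemma indep_weight_le kb k B : is_kbar f s kb -> ~ saturated f set0 ->
    (forall i, (i <= kb)%N -> forall Y, ~~ (Y \subset greedy_set s i) ->
       exists2 y, y \in Y &
         f (y |: greedy_set s i) - f (greedy_set s i) >=
         (gamma * f (greedy_set s i :|: Y) - alpha * f (greedy_set s i))
           / #|Y|%:R) ->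
    (k <= kb)%N -> B \in I -> (#|B| <= k)%N ->
  gamma * wt B <= alpha * f (greedy_set s k).
Proof.
move=> kbP nsat0 aug; have [/andP[_ kbU] _ _] := kbP.
elim: k B => [|k IHk] B lek BI cB.
  have -> : B = set0 by apply/eqP; rewrite -cards_eq0 -leqn0.
  by rewrite big_set0 mulr0 mulr_ge0 ?rank_ge0.
have SI := greedy_set_indep run kbP nsat0 (ltnW lek).
have leiU : (k < #|U|)%N := leq_trans lek kbU.
have [x [xS eS xmax]] := greedy_setS run leiU.
set S := greedy_set s k in SI xS eS xmax *.
have fS : f S <= f (greedy_set s k.+1) by rewrite eS rank_monotone ?subsetUr.
have [t /andP[tB wt_le]|tmin] :=
    pickP [pred t in B | w t <= f (greedy_set s k.+1) - f S].
  have := IHk (B :\ t) (ltnW lek).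
  rewrite (big_setD1 t tB) /= mulrDr => IH.
  have {}IH : gamma * wt (B :\ t) <= alpha * f S.
    apply: IH; first exact: indI.2 BI (subsetDl _ _).
    by move: cB; rewrite (cardsD1 t) tB.
  (* The weight of [t] is charged to the last gain via [gamma <= alpha], the rest of [B] to the
     previous greedy value. *)
  rewrite -[f (greedy_set _ _)](subrK (f S)) mulrDr lerD // ler_pM //.
  exact: ltW.
rewrite -rank_indep //; apply: (@le_trans _ _ (alpha * f S)); last first.
  exact: ler_wpM2l.
have [BS|BS] := boolP (B \subset S); first exact: gamma_alpha_sub.
apply: augment_gain0 (aug _ (ltnW lek) _ BS) _ => y yB.
(* A gain of [w y] outside [S] would be at most the last greedy gain, which [tmin] excludes. *)
have [//|e] := rank_insert_gain y run (ltnW leiU) SI.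
have [yS|yS] := boolP (y \in S); first by rewrite (setUidPr _) ?sub1set.
have := xmax _ yS; rewrite e => le1.
by have := tmin y; rewrite /= yB /= lerBrDr le1.
Qed.

Lemma greedy_bound k : weakly_augmentable gamma alpha f s ->
  gamma * f (optimal_set f k) <= alpha * f (greedy_set s k).
Proof.
move=> [kb kbP aug].
have [sat0|nsat0] := boolP [forall x, (x \notin set0) ==> (f (x |: set0) == f set0)].
  rewrite !saturated_set0_rank0 ?mulr0 // => x xS; apply/eqP;
    exact: (implyP (forallP sat0 x)).
have {}nsat0 : ~ saturated f set0.
  move=> sat; case/negP: nsat0; apply/forallP => x; apply/implyP => xS.
  by rewrite sat.
have [lek|ltk] := leqP k kb.
  have [Z [ZI ZX ->]] := rank_attained (optimal_set f k).
  apply: indep_weight_le kbP nsat0 aug lek ZI _.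
  exact: leq_trans (subset_leq_card ZX) (optimal_set_card _ _).
apply: (@le_trans _ _ (gamma * f setT)).
  by rewrite ler_pM2l // rank_monotone // subsetT.
apply: (@le_trans _ _ (alpha * f (greedy_set s kb))); last first.
  by rewrite ler_wpM2l // rank_monotone // sub_greedy_set // ltnW.
have [TS|TS] := boolP (setT \subset greedy_set s kb); first exact: gamma_alpha_sub.
apply: augment_gain0 (aug _ (leqnn _) _ TS) _ => y _.
have [yS|yS] := boolP (y \in greedy_set s kb).
  by rewrite (setUidPr _) ?sub1set.
by have [_ sat _] := kbP; exact: sat.
Qed.

End Augmentable.

(** Lets an independence system lie in the class given by its own rank quotient. An empty basis is
    contained in every other basis of the same set, so by maximality all of them are empty and the
    quotient is 1. *)
Lemma rank_quotient_gt0 : 0 < rank_quotient I :> R.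
Proof.
apply: lt_bigmin => // X _; apply: lt_bigmin => // B; rewrite inE => mB.
apply: lt_bigmin => // B'; rewrite inE => mB'.
have eqB0 A A' : maxset [pred Y : {set U} | (Y \in I) && (Y \subset X)] A ->
    maxset [pred Y : {set U} | (Y \in I) && (Y \subset X)] A' ->
    #|A| = 0 -> #|A'| = 0.
  move=> mA mA' /eqP; rewrite cards_eq0 => /eqP A0; subst A.
  by rewrite (maxsetsup mA (maxsetp mA') (sub0set _)) cards0.
rewrite /card_quotient; case: ifP => // nz.
rewrite divr_gt0 // ltr0n lt0n; apply: contraFN nz => /eqP z.
- by rewrite z (eqB0 _ _ mB mB' z).
- by rewrite z (eqB0 _ _ mB' mB z).
Qed.

Lemma rank_quotient_le1 : rank_quotient I <= 1 :> R.
Proof. exact: bigmin_le_id. Qed.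

End WeightedRank.

(** * The extremal instance for the lower bound *)

Section TwoBases.
Context {R : realFieldType} (n : nat) (c : R).
Context (n_gt0 : (0 < n)%N) (c_ge0 : 0 <= c) (c_le1 : c <= 1).

Local Notation U := ('I_n + 'I_n)%type.
Implicit Types (X Y Z : {set U}).

Definition left_part : {set U} := [set x | if x is inl _ then true else false].

(** The independent sets of the free matroid on the right copy of ['I_n] together with those of the
    uniform matroid of rank one on everything: a left element blocks all others. *)
Definition two_bases : {set {set U}} :=
  [set X : {set U} | (X \subset ~: left_part) || (#|X| <= 1)%N].

Definition two_weights (x : U) : R := if x is inl _ then 1 else c.

(* Once one left element is chosen, every other element has zero gain, so the
   ties may be broken in favour of the left elements. *)
Definition two_run : seq U := map inl (enum 'I_n) ++ map inr (enum 'I_n).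

Local Notation f := (weighted_rank two_bases two_weights).

Lemma two_bases_indep : independence_system two_bases.
Proof.
split=> [|X Y]; rewrite !inE ?sub0set // => /orP[YL|Y1] XY.
  by rewrite (subset_trans XY YL).
by rewrite (leq_trans (subset_leq_card XY) Y1) orbT.
Qed.

Lemma two_weights_ge0 x : 0 <= two_weights x.
Proof. by case: x. Qed.

Lemma two_weights_right X : X \subset ~: left_part ->
  \sum_(x in X) two_weights x = c * #|X|%:R.
Proof.
move=> XL; rewrite (eq_bigr (fun=> c)) ?sumr_const ?mulr_natr // => -[] // i.
by move=> /(subsetP XL); rewrite !inE.
Qed.

(** The best independent subset is either one left element, of weight 1, or all right elements of
    [X]; a single right element never beats the latter. *)
Lemma two_rankE X :
  f X = Num.max (~~ [disjoint X & left_part])%:R (c * #|X :\: left_part|%:R).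
Proof.
apply: le_anti; apply/andP; split.
  apply: (rank_le two_bases_indep two_weights_ge0) => Z.
  rewrite inE le_max => /orP[ZL|Z1] ZX.
    rewrite two_weights_right // ler_wpM2l ?orbT // ler_nat subset_leq_card //.
    by rewrite subsetD ZX disjoints_subset.
  have [/cards1P[z eZ]|] := boolP (#|Z| == 1)%N; last first.
    rewrite neq_ltn [(1 < _)%N]ltnNge Z1 orbF ltnS leqn0 cards_eq0 => /eqP ->.
    by rewrite big_set0 ler0n.
  rewrite eZ big_set1; rewrite eZ sub1set in ZX; case: z ZX {eZ} => i iX /=.
    suff -> : ~~ [disjoint X & left_part] by rewrite lexx.
    by apply/pred0Pn; exists (inl i); rewrite /= iX inE.
  apply/orP; right; apply: ler_peMr => //; rewrite ler1n.
  by apply/card_gt0P; exists (inr i); rewrite !inE iX.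
rewrite ge_max; apply/andP; split.
  case: (boolP [disjoint X & left_part]) => /= [_|].
    exact: (rank_ge0 two_bases_indep two_weights_ge0).
  move=> /pred0Pn[[i|i] /andP[/= iX]]; rewrite inE // => _.
  have -> : 1 = \sum_(x in [set inl i : U]) two_weights x by rewrite big_set1.
  by apply: weight_le_rank; rewrite ?sub1set // inE cards1 orbT.
rewrite -two_weights_right ?subsetDr //; apply: weight_le_rank.
  by rewrite inE subsetDr.
exact: subsetDl.
Qed.

Lemma two_rank_left X : ~~ [disjoint X & left_part] ->
  f X = Num.max 1 (c * #|X :\: left_part|%:R).
Proof. by rewrite two_rankE => ->. Qed.

Lemma card_left : #|left_part| = n.
Proof.
have -> : left_part = [set inl i | i in 'I_n].
  apply/setP => -[] i; rewrite inE.
    by apply/esym/imsetP; exists i.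
  by apply/esym/imsetP => -[].
by rewrite card_imset ?card_ord // => i j [].
Qed.

Lemma card_right X : (#|X :\: left_part| <= n)%N.
Proof.
apply: leq_trans (subset_leq_card (_ : _ \subset ~: left_part)) _.
  exact: subsetDr.
by rewrite -(leq_add2l n) -{1}card_left cardsC card_sum card_ord.
Qed.

Lemma size_map_enum_ord (T : Type) (h : 'I_n -> T) : size (map h (enum 'I_n)) = n.
Proof. by rewrite size_map size_enum_ord. Qed.

Lemma two_run_prefix p : (size p <= n)%N -> prefix p two_run -> [set:: p] \subset left_part.
Proof.
move=> pn /prefixP[t e]; apply/subsetP => x.
have -> : p = take (size p) (map inl (enum 'I_n)).
  have := congr1 (take (size p)) e.
  by rewrite take_size_cat // takel_cat ?size_map_enum_ord // => ->.
by rewrite !inE => /mem_take /mapP[i _ ->].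
Qed.

Lemma two_run_left p : (n <= size p)%N -> prefix p two_run -> left_part \subset [set:: p].
Proof.
move=> pn /prefixP[t e]; apply/subsetP => -[] i; rewrite !inE // => _.
have -> : p = take (size p) two_run by rewrite e take_size_cat.
rewrite /two_run take_cat size_map_enum_ord ltnNge pn /= mem_cat.
by rewrite map_f ?mem_enum.
Qed.

(** While left elements remain, a competitor brings in at most one right element, so [c <= 1] keeps
    its value at most 1. Afterwards every candidate is a right element and all candidates tie. *)
Lemma two_run_greedy : is_greedy_run f two_run.
Proof.
split; first by rewrite size_cat !size_map_enum_ord card_sum card_ord.
move=> p x t e.
have run_uniq : uniq two_run.
  have map_uniq (h : 'I_n -> U) : injective h -> uniq (map h (enum 'I_n)).
    by move=> h_inj; rewrite (map_inj_uniq h_inj) enum_uniq.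
  rewrite cat_uniq; apply/and3P; split; [by apply: map_uniq => ? ? [] | |
    by apply: map_uniq => ? ? []].
  by apply/hasPn => y /mapP[i _ ->]; apply/mapP => -[].
have xp : x \notin p.
  by move: run_uniq; rewrite e -cat_rcons cat_uniq rcons_uniq => /andP[/andP[]].
split=> // y yp; have [pn|pn] := ltnP (size p) n.
  have /subsetP pxL : [set:: rcons p x] \subset left_part.
    by apply: two_run_prefix; rewrite ?size_rcons // e -cat_rcons prefix_prefix.
  have xL : x \in left_part by apply: pxL; rewrite !inE mem_rcons mem_head.
  rewrite [leRHS]two_rank_left; last first.
    by apply/pred0Pn; exists x; rewrite /= setU11.
  rewrite le_max two_rankE ge_max lern1 leq_b1 /=.
  apply/orP; left; apply: mulr_ile1; rewrite ?ler0n // lern1.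
  apply: leq_trans (subset_leq_card (_ : _ \subset [set y])) _; last by rewrite cards1.
  apply/subsetP => z; rewrite in_setD in_setU1 in_set1 => /andP[zL /orP[//|zp]].
  by case/negP: zL; apply: pxL; rewrite inE in zp; rewrite inE mem_rcons inE zp orbT.
have pL : left_part \subset [set:: p] by apply: two_run_left => //; rewrite e prefix_prefix.
have right z : z \notin p -> #|(z |: [set:: p]) :\: left_part| = #|[set:: p] :\: left_part|.+1.
  move=> zp; have zL : z \notin left_part.
    by apply: contra zp => /(subsetP pL); rewrite inE.
  by rewrite setDUl (setDidPl _) ?disjoints1 // cardsU1 !inE (negPf zp) andbF.
have meets z : ~~ [disjoint z |: [set:: p] & left_part].
  apply/pred0Pn; exists (inl (Ordinal n_gt0)); rewrite /= inE (subsetP pL) ?orbT ?inE //.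
by rewrite !two_rank_left // !right.
Qed.

Lemma two_greedy_n : greedy_set two_run n = left_part.
Proof.
have sz : size two_run = (n + n)%N by rewrite size_cat !size_map_enum_ord.
have szt : size (take n two_run) = n.
  by apply: size_takel; rewrite sz leq_addr.
apply/eqP; rewrite eqEsubset; apply/andP; split.
  by apply: two_run_prefix; rewrite ?szt // prefix_take.
by apply: two_run_left; rewrite ?szt // prefix_take.
Qed.

Lemma two_rank_left_part : f left_part = 1.
Proof.
rewrite two_rank_left ?setDv ?cards0 ?mulr0 ?max_l //.
by apply/pred0Pn; exists (inl (Ordinal n_gt0)); rewrite /= inE.
Qed.

Lemma two_rank_right_part : f (~: left_part) = c * n%:R.
Proof.
rewrite two_rankE setDE setIid disjoints_subset subxx /=.
have -> : #|~: left_part| = n.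
  by apply/eqP; rewrite -(eqn_add2l n) -{1}card_left cardsC card_sum card_ord.
by rewrite max_r // mulr_ge0 ?ler0n.
Qed.

Lemma two_greedy_1 : exists2 x, x \in left_part & greedy_set two_run 1 = [set x].
Proof.
have U_gt0 : (0 < #|{: U}|)%N by rewrite card_sum card_ord addn_gt0 n_gt0.
have [x [_ e _]] := greedy_setS two_run_greedy U_gt0.
rewrite greedy_set0 setU0 in e; exists x => //.
by rewrite -two_greedy_n; apply: (subsetP (sub_greedy_set _ n_gt0)); rewrite e set11.
Qed.

Lemma two_rank_pair x y : x \in left_part -> f (y |: [set x]) = 1.
Proof.
move=> xL; rewrite two_rank_left; last first.
  by apply/pred0Pn; exists x; rewrite /= xL in_setU !in_set1 eqxx orbT.
apply/max_l/mulr_ile1; rewrite ?ler0n // lern1.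
apply: leq_trans (subset_leq_card (_ : _ \subset [set y])) _; last by rewrite cards1.
apply/subsetP => z; rewrite in_setD in_setU1 !in_set1 => /andP[zL /orP[//|/eqP zx]].
by rewrite zx xL in zL.
Qed.

Lemma two_rank_left1 x : x \in left_part -> f [set x] = 1.
Proof. by rewrite -[in f _](setUid [set x]); exact: two_rank_pair. Qed.

(** Beside one left element, a further element contributes at most [c <= 1]. Saturation thus occurs
    at the least admissible index, and augmentability concerns only the empty set and one
    singleton. *)
Lemma two_kbar : is_kbar f two_run 1.
Proof.
have [x xL eS] := two_greedy_1.
split; [by rewrite card_sum card_ord addn_gt0 n_gt0 | | by move=> j /andP[]].
by rewrite eS => y _; rewrite two_rank_pair // two_rank_left1.
Qed.

Lemma two_weakly_augmentable gamma alpha : 0 < gamma -> gamma <= 1 ->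
    gamma <= alpha -> gamma * (c * n%:R) <= alpha ->
  weakly_augmentable gamma alpha f two_run.
Proof.
move=> g0 g1 ga gcn; exists 1%N; first exact: two_kbar.
have f1 x : f [set x] <= 1.
  by rewrite two_rankE ge_max lern1 leq_b1 mulr_ile1 ?ler0n // lern1 -(cards1 x) subset_leq_card ?subsetDl.
have f0 : f set0 = 0.
  by rewrite two_rankE set0D cards0 mulr0 disjoints_subset sub0set maxxx.
case=> [|[|//]] _ Y.
  rewrite greedy_set0 subset0 => /set0Pn[y0 y0Y] /=.
  have Y0 : 0 < #|Y|%:R :> R by rewrite ltr0n; apply/card_gt0P; exists y0.
  (* As [gamma <= 1], at the empty set it suffices to find an element of weight at least
     [f Y / #|Y|]: a left one if [Y] has any, otherwise an arbitrary one. *)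
  have gf b : f Y <= b * #|Y|%:R -> gamma * f Y / #|Y|%:R <= b.
    move=> fY; rewrite ler_pdivrMr //; apply: le_trans fY.
    by rewrite ler_piMl // (rank_ge0 two_bases_indep two_weights_ge0).
  have [dY|/pred0Pn[y /andP[/= yY yL]]] := boolP [disjoint Y & left_part].
    exists y0 => //; rewrite set0U setU0 f0 mulr0 !subr0; apply: gf.
    rewrite !two_rankE dY (setDidPl dY) max_r ?mulr_ge0 ?ler0n //.
    rewrite ler_wpM2r ?ler0n // le_max.
    have y0L : y0 \notin left_part by rewrite (disjointFr dY).
    by rewrite (setDidPl _) ?disjoints1 // cards1 mulr1 lexx orbT.
  exists y => //; rewrite set0U setU0 f0 mulr0 !subr0; apply: gf.
  rewrite two_rank_left1 // mul1r two_rankE ge_max.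
  apply/andP; split; first by rewrite ler_nat (leq_trans (leq_b1 _)) // -(ltr0n R).
  rewrite -[leRHS]mul1r ler_pM ?ler0n // ler_nat.
  by rewrite subset_leq_card // subsetDl.
have [x xL ->] := two_greedy_1 => /subsetPn[y yY yx] /=.
(* At the singleton all gains are zero, so [gamma] times the larger of 1 and [c * n%:R] has to stay
   below [alpha]. *)
exists y => //; rewrite two_rank_pair // two_rank_left1 // subrr mulr1.
rewrite pmulr_lle0 ?invr_gt0 ?ltr0n; last by apply/card_gt0P; exists y.
rewrite subr_le0 mulrC -ler_pdivlMr // two_rankE ge_max !ler_pdivlMr //.
apply/andP; split.
  by apply: le_trans ga; rewrite ler_piMl ?(ltW g0) // lern1 leq_b1.
apply: le_trans gcn; rewrite mulrC ler_pM2l // ler_wpM2l // ler_nat.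
exact: card_right.
Qed.

End TwoBases.

From mathcomp Require Import all_classical all_reals all_analysis.
Local Open Scope classical_set_scope.

(** * The bounds in terms of the extended-real ratio *)

Section ApproximationRatio.
Context {R : realType} {gamma alpha : R}.
Context (gamma_gt0 : 0 < gamma) (gamma_le : gamma <= alpha).

Lemma value_ratio_le (a b : R) : 0 <= a -> 0 <= b -> gamma * a <= alpha * b ->
  (value_ratio a b <= (alpha / gamma)%:E)%E.
Proof.
move=> a_ge0 b_ge0 ab; rewrite /value_ratio.
have [b0|b_neq0] := eqVneq b 0.
  (* A zero greedy value forces a zero optimum, so the infinite convention never occurs and the
     ratio is 1. *)
  have -> : a = 0.
    by apply: le_anti; rewrite a_ge0 andbT -(pmulr_rle0 _ gamma_gt0) (le_trans ab) // b0 mulr0.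
  by rewrite eqxx lee_fin ler_pdivlMr // mul1r.
have b_gt0 : 0 < b by rewrite lt_neqAle eq_sym b_neq0.
by rewrite lee_fin ler_pdivrMr // mulrAC ler_pdivlMr // mulrC.
Qed.

Lemma greedy_ratio_le (f : greedy_function R) :
  weakly_augmentable_class gamma alpha f -> independence_system_class f ->
  (greedy_ratio f <= (alpha / gamma)%:E)%E.
Proof.
move=> [_ aug] [q _ [I [w [indI w_ge0 _ fE]]]].
have {}fE : f = weighted_rank I w :> ({set ground f} -> R) by apply: funext.
apply: bigmax_le => [|k _]; first exact: leNye.
apply: value_ratio_le; [exact: set_fun_ge0 | exact: set_fun_ge0 |].
have := runP f; move: aug; rewrite fE => aug run_f.
exact: greedy_bound.
Qed.

Lemma greedy_ratio_attained : gamma <= 1 ->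
  exists2 f : greedy_function R,
    weakly_augmentable_class gamma alpha f /\ independence_system_class f &
    ((alpha / gamma)%:E <= greedy_ratio f)%E.
Proof.
move=> gamma_le1.
have ag_ge1 : 1 <= alpha / gamma by rewrite ler_pdivlMr // mul1r.
(* The least integer above [alpha / gamma], so that [c] is at most 1 while [n] right elements weigh
   exactly [alpha / gamma]. *)
set n := (Num.truncn (alpha / gamma)).+1.
have n_gt0 : 0 < n%:R :> R by rewrite ltr0n.
pose c := alpha / gamma / n%:R.
have c_ge0 : 0 <= c by rewrite divr_ge0 ?ler0n // (le_trans ler01).
have c_le1 : c <= 1 by rewrite ler_pdivrMr // mul1r ltW // truncnS_gt.
have cn : c * n%:R = alpha / gamma by rewrite divfK // gt_eqF.
have indI := @two_bases_indep n.
have w_ge0 := @two_weights_ge0 R n c c_ge0.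
pose F := GreedyFunction (rank_ge0 indI w_ge0)
  (@two_run_greedy R n c isT c_ge0 c_le1).
exists F.
  split; first split.
  - exact: rank_monotone.
  - apply: two_weakly_augmentable => //.
    by rewrite cn mulrC divfK // gt_eqF.
  - exists (rank_quotient (two_bases n)).
      by rewrite rank_quotient_gt0 // rank_quotient_le1.
    by exists (two_bases n), (two_weights c).
have nU : n \in index_iota 1 #|ground F|.+1.
  by rewrite mem_index_iota /= card_sum card_ord ltnS leq_addr.
(* The index [k = n] is the witness: greedy holds exactly the left part, and the right part competes
   for the optimum. *)
rewrite /greedy_ratio; apply: (le_trans _ (Order.TotalTheory.le_bigmax_seq _ _ _ _ nU isT)).
rewrite /F /= /value_ratio two_greedy_n two_rank_left_part // oner_eq0 divr1.
rewrite lee_fin -cn -(two_rank_right_part n c_ge0); apply: optimal_set_max.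
by rewrite -(leq_add2l #|left_part n|) cardsC card_left card_sum card_ord.
Qed.

End ApproximationRatio.

Theorem theorem8 (R : realType) (gamma alpha : R)
    (gamma_gt0 : 0 < gamma) (gamma_le1 : gamma <= 1)
    (alpha_ge_gamma : gamma <= alpha) :
  approximation_ratio
    (fun f : greedy_function R =>
       weakly_augmentable_class gamma alpha f /\ independence_system_class f)
  = (alpha / gamma)%:E.
Proof.
apply: le_anti; apply/andP; split.
  by apply: ge_ereal_sup => _ [f [aug ind] ->]; exact: greedy_ratio_le.
have [f Ff le_f] := greedy_ratio_attained gamma_gt0 alpha_ge_gamma gamma_le1.
by apply: le_trans le_f _; apply: ereal_sup_ubound; exists f.
Qed.
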